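(* For every expression $\mathbf E$ there is an expression $\mathbf E'$ with $\mathrm{Rel}(\mathbf E)=\mathrm{Rel}(\mathbf E')$ in which $*$ is only applied to monotone relations, i.e. for every subexpression of $\mathbf E'$ of the form $\mathbf F^{*}$ the relation $\mathrm{Rel}(\mathbf F)$ is monotone.
   Context: $\mathbb{N}$ contains $0$. A vector addition system with states (VASS) of dimension $d\in\mathbb{N}$ is a finite directed multigraph $\mathcal V=(Q,E)$ with edges $e$ labelled by vectors $f(e)\in\mathbb{Z}^d$. Configurations are elements of $Q\times\mathbb{N}^d$; an edge $e$ from $p$ to $p'$ gives steps $(p,\mathbf x)\to_{\mathcal V}(p',\mathbf x+f(e))$ whenever $\mathbf x,\mathbf x+f(e)\in\mathbb{N}^d$; $\to_{\mathcal V}^{*}$ is the reflexive transitive closure. A relation $\mathbf X\subseteq\mathbb{N}^{d'}\times\mathbb{N}^{d''}$ is a VASS section if there exist a VASS $\mathcal V$ of dimension $d\ge d',d''$, states $p,q$ and vectors $\mathbf b_s\in\mathbb{N}^{d-d'}$, $\mathbf b_t\in\mathbb{N}^{d-d''}$ with $\mathbf X=\{(\mathbf x,\mathbf y)\in\mathbb{N}^{d'}\times\mathbb{N}^{d''}\mid (p,(\mathbf b_s,\mathbf x))\to_{\mathcal V}^{*}(q,(\mathbf b_t,\mathbf y))\}$. Expressions: every expression $\mathbf E$ has an input dimension $in(\mathbf E)\in\mathbb{N}$ and an output dimension $out(\mathbf E)\in\mathbb{N}$ and defines a relation $\mathrm{Rel}(\mathbf E)\subseteq\mathbb{N}^{in(\mathbf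 E)}\times\mathbb{N}^{out(\mathbf E)}$. They are built inductively: (1) every VASS section $\mathbf Y\subseteq\mathbb{N}^{d'}\times\mathbb{N}^{d''}$ is an expression with dimensions $d',d''$ and $\mathrm{Rel}(\mathbf Y)=\mathbf Y$; (2) if $out(\mathbf E_1)=in(\mathbf E_2)$ then $\mathbf E_1\circ\mathbf E_2$ is an expression with dimensions $in(\mathbf E_1),out(\mathbf E_2)$ and $\mathrm{Rel}(\mathbf E_1\circ\mathbf E_2)=\mathrm{Rel}(\mathbf E_1)\circ\mathrm{Rel}(\mathbf E_2)$, where $\mathbf{R}_1\circ\mathbf{R}_2=\{(\mathbf v,\mathbf w)\mid\exists \mathbf x:(\mathbf v,\mathbf x)\in\mathbf R_1,(\mathbf x,\mathbf w)\in\mathbf R_2\}$; (3) if $\mathbf E_1,\mathbf E_2$ have the same input dimension and the same output dimension, then $\mathbf E_1\cup\mathbf E_2$ is an expression with these dimensions and $\mathrm{Rel}(\mathbf E_1\cup\mathbf E_2)=\mathrm{Rel}(\mathbf E_1)\cup\mathrm{Rel}(\mathbf E_2)$; (4) if $in(\mathbf E)=out(\mathbf E)=d'$ then $\mathbf E^{*}$ is an expression with dimensions $d',d'$, and $\mathrm{Rel}(\mathbf E^{*})$ is the reflexive transitive closure of $\mathrm{Rel}(\mathbf E)$ on $\mathbb{N}^{d'}$. A relation $\mathbf R\subseteq\mathbb{N}^{d'}\times\mathbb{N}^{d'}$ is monotone if $(\mathbf x,\mathbf y)\in\mathbf R$ implies $(\mathbf x+\mathbf e_i,\mathbf y+\mathbf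 e_i)\in\mathbf R$ for every unit vector $\mathbf e_i\in\mathbb{N}^{d'}$. *)

(* Defs.v *)
From HB Require Import structures.
From mathcomp Require Import all_boot all_order all_algebra.
From Stdlib Require Import Relations.
Set Implicit Arguments.
Unset Strict Implicit.
Unset Printing Implicit Defensive.
Import GRing.Theory.
Local Open Scope ring_scope.

Definition vrel (m n : nat) := 'rV[nat]_m -> 'rV[nat]_n -> Prop.

(* Edges form a type of their own, so parallel edges with equal labels are
   allowed (multigraph). *)
Record vass (d : nat) := Vass {
  vstate : finType;
  vedge : finType;
  vsrc : vedge -> vstate;
  vtgt : vedge -> vstate;
  vlabel : vedge -> 'rV[int]_d }.

Definition config d (V : vass d) : Type := (vstate V * 'rV[nat]_d)%type.

(* The equation lives in Z^d; nonnegativity of both ends is carried by the type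
   of configurations. *)
Definition vstep d (V : vass d) (c c' : config V) : Prop :=
  exists e : vedge V,
    [/\ vsrc e = c.1, vtgt e = c'.1 &
        map_mx Posz c'.2 = map_mx Posz c.2 + vlabel e].

Definition vreach d (V : vass d) : config V -> config V -> Prop :=
  clos_refl_trans (config V) (@vstep d V).

(* The vector (b, x) of N^d. The visible part x always occupies the last k
   coordinates, so input and output of a section are aligned on their last
   coordinates; sections are not taken up to permutation of coordinates, which
   would allow arbitrary (not only nested) zero tests. *)
Definition pad d k (hk : (k <= d)%N) (b : 'rV[nat]_(d - k)) (x : 'rV[nat]_k) :
  'rV[nat]_d := castmx (erefl 1%N, subnK hk) (row_mx b x).

Definition vass_section m n (X : vrel m n) : Prop :=
  exists (d : nat) (hm : (m <= d)%N) (hn : (n <= d)%N) (V : vass d)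
         (p q : vstate V) (bs : 'rV[nat]_(d - m)) (bt : 'rV[nat]_(d - n)),
    forall x y, X x y <-> vreach (p, pad hm bs x) (q, pad hn bt y).

(* The indices are the input and the output dimension. *)
Inductive expr : nat -> nat -> Type :=
  | ESection m n (Y : vrel m n) of vass_section Y : expr m n
  | EComp m n k of expr m n & expr n k : expr m k
  | EUnion m n of expr m n & expr m n : expr m n
  | EStar m of expr m m : expr m m.

Fixpoint Rel m n (E : expr m n) : vrel m n :=
  match E in expr m n return vrel m n with
  | ESection _ _ Y _ => Y
  | EComp _ _ _ E1 E2 => fun v w => exists x, Rel E1 v x /\ Rel E2 x w
  | EUnion _ _ E1 E2 => fun v w => Rel E1 v w \/ Rel E2 v w
  | EStar m E1 => clos_refl_trans 'rV[nat]_m (Rel E1)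
  end.

Inductive subexpr k l (F : expr k l) : forall m n, expr m n -> Prop :=
  | SubRefl : subexpr F F
  | SubCompL m n p (E1 : expr m n) (E2 : expr n p) :
      subexpr F E1 -> subexpr F (EComp E1 E2)
  | SubCompR m n p (E1 : expr m n) (E2 : expr n p) :
      subexpr F E2 -> subexpr F (EComp E1 E2)
  | SubUnionL m n (E1 E2 : expr m n) : subexpr F E1 -> subexpr F (EUnion E1 E2)
  | SubUnionR m n (E1 E2 : expr m n) : subexpr F E2 -> subexpr F (EUnion E1 E2)
  | SubStar m (E1 : expr m m) : subexpr F E1 -> subexpr F (EStar E1).

Definition monotone m (R : vrel m m) : Prop :=
  forall (x y : 'rV[nat]_m) (i : 'I_m),
    R x y -> R (x + delta_mx 0 i) (y + delta_mx 0 i).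

(* Main.v *)
(** Split each path through an expression at its visits to the smallest
    dimension [k] that occurs.  An expression then becomes a finite union of
    expressions in dimensions larger than [k] and of relations [b c] factoring
    through [N^k], and this form survives iteration because
    [(r + b c)^* = r^* + r^* b (c r^* b)^* c r^*].  Here [c r^* b] is a relation
    on [N^k], and it is monotone because sections respect the addition of a unit
    vector to one of their last [k] coordinates.  Hence downward induction on
    [k] removes all stars of non-monotone relations. *)
Require Import Defs.
From mathcomp Require Import all_boot all_order all_algebra.
From mathcomp Require Import zify.
From Stdlib Require Import Relations.
Set Implicit Arguments.
Unset Strict Implicit.
Unset Printing Implicit Defensive.
Import GRing.Theory.
Local Open Scope ring_scope.

Notation star := (clos_refl_trans _).

(** * Composition, union and iteration of relations *)

Definition vcomp m n k (R : vrel m n) (S : vrel n k) : vrel m k :=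
  fun v w => exists x, R v x /\ S x w.

Definition vunion m n (R S : vrel m n) : vrel m n := fun v w => R v w \/ S v w.

Definition vrel_eq m n (R S : vrel m n) : Prop := forall x y, R x y <-> S x y.

Lemma star_mono T (R S : relation T) x y :
  (forall u v, R u v -> S u v) -> star R x y -> star S x y.
Proof.
move=> RS; elim=> [u v /RS|u|u v w _ uv _ vw]; first exact: rt_step.
  exact: rt_refl.
exact: rt_trans uv vw.
Qed.

Lemma vrel_eq_star m (R S : vrel m m) :
  vrel_eq R S -> vrel_eq (star R) (star S).
Proof. by move=> RS x y; split; apply: star_mono => u v /RS. Qed.

(** A prepended [r] step extends the leading [star r]. A prepended [b c] step creates a new first
    visit to N^k, and the stretch from it to the old first visit becomes one more loop. *)
Lemma star_union_comp m k (r : vrel m m) (b : vrel m k) (c : vrel k m) :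
  vrel_eq (star (vunion r (vcomp b c)))
    (vunion (star r)
       (vcomp (vcomp (vcomp (star r) b) (star (vcomp c (vcomp (star r) b))))
              (vcomp c (star r)))).
Proof.
move=> x y; split.
  move=> /(clos_rt_rt1n _ _ _ _) xy; elim: xy => {x y} [x|x z y xz _ IH]; first by left; exact: rt_refl.
  case: xz => [rxz|[u [bxu cuz]]].
    case: IH => [rzy|[v [[u [[z' [rz bu]] uv]] vy]]].
      by left; apply: rt_trans rzy; exact: rt_step.
    right; exists v; split=> //; exists u; split=> //; exists z'; split=> //.
    by apply: rt_trans rz; exact: rt_step.
  right; case: IH => [rzy|[v [[w [zw wv]] vy]]].
    exists u; split; last by exists z.
    exists u; split; last exact: rt_refl.
    by exists x; split=> //; exact: rt_refl.
  exists v; split=> //; exists u; split.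
    by exists x; split=> //; exact: rt_refl.
  by apply: rt_trans wv; apply: rt_step; exists z.
have rS u v : star r u v -> star (vunion r (vcomp b c)) u v.
  by apply: star_mono => ? ?; left.
(* In each loop, [c] completes the [b] left pending by the previous visit, and the final [b] stays
   pending for the next; hence the quantification over [x] and [y]. *)
have loop u v : star (vcomp c (vcomp (star r) b)) u v ->
    forall x y, b x u -> c v y -> star (vunion r (vcomp b c)) x y.
  move=> /(clos_rt_rt1n _ _ _ _) uv; elim: uv => {u v} [u|u w v [z [cz [z' [rz bz]]]] _ IH] x' y' bx cy.
    by apply: rt_step; right; exists u.
  apply: (rt_trans _ _ _ z); first by apply: rt_step; right; exists u.
  by apply: rt_trans (rS _ _ rz) _; exact: IH.
case=> [/rS //|[v [[u [[x' [rx bx]] uv]] [y' [cy ry]]]]].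
apply: rt_trans (rS _ _ rx) _; apply: rt_trans (rS _ _ ry).
exact: loop uv _ _ bx cy.
Qed.

(** * Monotonicity in the last coordinates *)

(* Coordinates are counted from the end, so that [tail_unit m c] and
   [tail_unit n c] name the same coordinate of a section; it is [0] unless
   [0 < c <= m]. *)
Definition tail_unit m (c : nat) : 'rV[nat]_m := \row_j nat_of_bool (j + c == m)%N.

(** Unlike [monotone], this makes sense between different dimensions, so it can be followed through
    compositions. *)
Definition tail_monotone k m n (R : vrel m n) : Prop :=
  forall x y c, (c <= k)%N -> R x y -> R (x + tail_unit m c) (y + tail_unit n c).

Lemma tail_monotone_eq k m n (R S : vrel m n) :
  vrel_eq R S -> tail_monotone k R -> tail_monotone k S.
Proof. by move=> RS mR x y c ck /RS /(mR x y c ck) /RS. Qed.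

Lemma tail_monotone_comp k m n l (R : vrel m n) (S : vrel n l) :
  tail_monotone k R -> tail_monotone k S -> tail_monotone k (vcomp R S).
Proof.
move=> mR mS x y c ck [z [xz zy]].
by exists (z + tail_unit n c); split; [exact: mR|exact: mS].
Qed.

Lemma tail_monotone_union k m n (R S : vrel m n) :
  tail_monotone k R -> tail_monotone k S -> tail_monotone k (vunion R S).
Proof. by move=> mR mS x y c ck [xy|xy]; [left; exact: mR|right; exact: mS]. Qed.

Lemma tail_monotone_star k m (R : vrel m m) :
  tail_monotone k R -> tail_monotone k (star R).
Proof.
move=> mR x y c ck; elim=> [u v uv|u|u v w _ uv _ vw].
- by apply: rt_step; exact: mR.
- exact: rt_refl.
- exact: rt_trans uv vw.
Qed.

Lemma monotone_tail k (R : vrel k k) : tail_monotone k R -> monotone R.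
Proof.
move=> mR x y i xy.
have -> : delta_mx 0 i = tail_unit k (k - i) :> 'rV[nat]_k.
  apply/rowP=> j; rewrite !mxE eqxx -val_eqE natn /=; congr nat_of_bool.
  by have := ltn_ord i; have := ltn_ord j; lia.
by apply: mR => //; exact: leq_subr.
Qed.

(** Adding [w] keeps all configurations of a run nonnegative, so the same edges can be fired. *)
Lemma vreach_add d (V : vass d) (p q : vstate V) (u v w : 'rV[nat]_d) :
  vreach (p, u) (q, v) -> vreach (p, u + w) (q, v + w).
Proof.
(* With both ends written as projections, the induction can treat configurations as variables. *)
rewrite -[(p, u + w)]/((p, u).1, (p, u).2 + w) -[(q, v + w)]/((q, v).1, (q, v).2 + w).
elim=> [c c' [e [sc tc lc]]|c|c c' c'' _ H _ H'].
- apply: rt_step; exists e; split=> //=.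
  apply/rowP=> j; move/rowP/(_ j): lc; rewrite !mxE /=; lia.
- exact: rt_refl.
- exact: rt_trans H H'.
Qed.

Lemma pad_tail_unit d m (hm : (m <= d)%N) b x c : (c <= m)%N ->
  pad hm b (x + tail_unit m c) = pad hm b x + tail_unit d c.
Proof.
move=> cm; apply/rowP=> j; rewrite mxE /pad !castmxE !mxE /=.
case: splitP => j' /= jE; rewrite ?mxE /=.
  (* A padding coordinate has [j < d - m] while [c <= m], so the unit vector misses it. *)
  have -> : (j + c == d)%N = false by have := ltn_ord j'; lia.
  by rewrite addr0.
congr (_ + nat_of_bool _); lia.
Qed.

Lemma tail_monotone_section k m n (R : vrel m n) :
  (k <= m)%N -> (k <= n)%N -> vass_section R -> tail_monotone k R.
Proof.
move=> km kn [d [hm [hn [V [p [q [bs [bt RE]]]]]]]] x y c ck /RE xy; apply/RE.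
rewrite !pad_tail_unit ?(leq_trans ck) //; exact: vreach_add.
Qed.

(** * The identity as a section of an edgeless VASS *)

Definition still_vass d : vass d :=
  @Vass d unit void (fun e => match e with end) (fun e => match e with end)
    (fun e => match e with end).

Lemma vass_section_id m : @vass_section m m eq.
Proof.
exists m, (leqnn m), (leqnn m), (still_vass m), tt, tt, 0, 0 => x y.
split=> [->|]; first exact: rt_refl.
(* The padding has [m - m] coordinates here, so [pad] is merely a cast. *)
have padE z j : pad (leqnn m) 0 z 0 j = z 0 j.
  rewrite /pad castmxE !mxE /=; case: splitP => j' /= jE.
    by have := ltn_ord j'; lia.
  by congr (z _ _); apply: val_inj => //=; lia.
move=> xy; suff /rowP e : pad (leqnn m) 0 x = pad (leqnn m) 0 y.
  by apply/rowP=> j; rewrite -[LHS]padE -[RHS]padE.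
move: xy; rewrite -[LHS]/(tt : vstate (still_vass m), pad (leqnn m) 0 x).2.
rewrite -[RHS]/(tt : vstate (still_vass m), pad (leqnn m) 0 y).2.
by elim=> [c c' [[]]|//|c c' c'' _ -> _ ->].
Qed.

Definition EId m : expr m m := ESection (vass_section_id m).

(** * Expressions whose stars are monotone *)

Fixpoint monotone_stars m n (E : expr m n) : Prop :=
  match E with
  | ESection _ _ _ _ => True
  | EComp _ _ _ E1 E2 => monotone_stars E1 /\ monotone_stars E2
  | EUnion _ _ E1 E2 => monotone_stars E1 /\ monotone_stars E2
  | EStar _ E1 => monotone (Rel E1) /\ monotone_stars E1
  end.

Lemma monotone_stars_sub k l (F : expr k l) m n (E : expr m n) :
  subexpr F E -> monotone_stars E -> monotone_stars F.
Proof. by elim=> //= {m n E} *; intuition. Qed.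

Definition good m n (R : vrel m n) : Prop :=
  exists2 E : expr m n, vrel_eq R (Rel E) & monotone_stars E.

Lemma good_eq m n (R S : vrel m n) : vrel_eq R S -> good R -> good S.
Proof.
by move=> RS [E RE gE]; exists E => // x y; rewrite -(RS x y) (RE x y).
Qed.

Lemma good_section m n (R : vrel m n) : vass_section R -> good R.
Proof. by move=> sR; exists (ESection sR). Qed.

Lemma good_comp m n k (R : vrel m n) (S : vrel n k) :
  good R -> good S -> good (vcomp R S).
Proof.
move=> [E RE gE] [F SF gF]; exists (EComp E F) => // x y.
by split=> -[z [/RE xz /SF zy]]; exists z.
Qed.

Lemma good_union m n (R S : vrel m n) : good R -> good S -> good (vunion R S).
Proof.
move=> [E RE gE] [F SF gF]; exists (EUnion E F) => // x y.
by split=> -[/RE xy|/SF xy]; [left|right|left|right].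
Qed.

(** The second half is what allows a star to be put on such a relation when [m = n = k]. *)
Definition nice k m n (R : vrel m n) : Prop := good R /\ tail_monotone k R.

Lemma nice_eq k m n (R S : vrel m n) : vrel_eq R S -> nice k R -> nice k S.
Proof.
by move=> RS [gR mR]; split; [exact: good_eq gR|exact: tail_monotone_eq mR].
Qed.

Lemma nice_section k m n (R : vrel m n) :
  (k <= m)%N -> (k <= n)%N -> vass_section R -> nice k R.
Proof.
by move=> km kn sR; split; [exact: good_section|exact: tail_monotone_section].
Qed.

Lemma nice_id k : nice k (@eq 'rV[nat]_k).
Proof. exact: nice_section (vass_section_id k). Qed.

Lemma nice_comp k m n l (R : vrel m n) (S : vrel n l) :
  nice k R -> nice k S -> nice k (vcomp R S).
Proof.
move=> [gR mR] [gS mS]; split; first exact: good_comp.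
exact: tail_monotone_comp.
Qed.

Lemma nice_union k m n (R S : vrel m n) :
  nice k R -> nice k S -> nice k (vunion R S).
Proof.
move=> [gR mR] [gS mS]; split; first exact: good_union.
exact: tail_monotone_union.
Qed.

Lemma nice_star k (R : vrel k k) : nice k R -> nice k (star R).
Proof.
move=> [[E RE gE] mR]; split; last exact: tail_monotone_star.
exists (EStar E); first exact: vrel_eq_star.
split=> //; apply: monotone_tail; exact: tail_monotone_eq RE mR.
Qed.

(** * Dimensions occurring in an expression *)

Fixpoint all_dims (P : pred nat) m n (E : expr m n) : bool :=
  [&& P m, P n &
   match E with
   | ESection _ _ _ _ => true
   | EComp _ _ _ E1 E2 => all_dims P E1 && all_dims P E2
   | EUnion _ _ E1 E2 => all_dims P E1 && all_dims P E2
   | EStar _ E1 => all_dims P E1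
   end].

Lemma all_dims_in P m n (E : expr m n) : all_dims P E -> P m && P n.
Proof. by case: E => [????|?????|????|??] /and3P[Pm Pn _]; apply/andP. Qed.

Lemma all_dims_sub (P Q : pred nat) m n (E : expr m n) :
  (forall j, P j -> Q j) -> all_dims P E -> all_dims Q E.
Proof.
move=> PQ; elim: E => [{}m {}n Y sY|{}m {}n l E IHE F IHF|{}m {}n E IHE F IHF|{}m E IHE] /=
  /and3P[/PQ Qm /PQ Qn]; rewrite ?Qm ?Qn //=.
- by case/andP=> /IHE -> /IHF ->.
- by case/andP=> /IHE -> /IHF ->.
Qed.

Lemma all_dims_bounded m n (E : expr m n) :
  exists D, all_dims (fun j => j <= D)%N E.
Proof.
have wid (a b : nat) : (a <= b)%N -> forall j, (j <= a)%N -> (j <= b)%N.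
  by move=> ab j /leq_trans; exact.
elim: E => {m n} [m n Y sY|m n l E [D DE] F [D' DF]|m n E [D DE] F [D' DF]|m E [D DE]].
- by exists (maxn m n); rewrite /= leq_maxl leq_maxr.
- exists (maxn D D'); rewrite /=.
  have {}DE := all_dims_sub (wid _ _ (leq_maxl D D')) DE.
  have {}DF := all_dims_sub (wid _ _ (leq_maxr D D')) DF.
  have /andP[-> _] := all_dims_in DE; have /andP[_ ->] := all_dims_in DF.
  by rewrite DE DF.
- exists (maxn D D'); rewrite /=.
  have {}DE := all_dims_sub (wid _ _ (leq_maxl D D')) DE.
  have {}DF := all_dims_sub (wid _ _ (leq_maxr D D')) DF.
  by have /andP[-> ->] := all_dims_in DE; rewrite DE DF.
- by exists D; rewrite /= DE; have /andP[-> _] := all_dims_in DE.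
Qed.

(** All intermediate vectors have at least [k] coordinates, so a shift of the last [k] can be
    carried along the whole path, even through stars that are not monotone. *)
Lemma tail_monotone_Rel k (P : pred nat) m n (E : expr m n) :
  (forall j, P j -> (k <= j)%N) -> all_dims P E -> tail_monotone k (Rel E).
Proof.
move=> Pk; elim: E => [{}m {}n Y sY|{}m {}n l E IHE F IHF|{}m {}n E IHE F IHF|{}m E IHE] /=
  /and3P[/Pk km /Pk kn].
- by move=> _; exact: tail_monotone_section.
- by case/andP=> /IHE mE /IHF mF; exact: tail_monotone_comp.
- by case/andP=> /IHE mE /IHF mF; exact: tail_monotone_union.
- by move/IHE; exact: tail_monotone_star.
Qed.

(** * Splitting off the smallest dimension *)

Definition tame (P : pred nat) : Prop :=
  forall m n (E : expr m n), all_dims P E -> good (Rel E).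

(* [P] holds of the dimensions above [k]. *)
Inductive factored (P : pred nat) k m n : vrel m n -> Prop :=
  | FacAbove (E : expr m n) : all_dims P E -> factored P k (Rel E)
  | FacThrough (b : vrel m k) (c : vrel k n) :
      nice k b -> nice k c -> factored P k (vcomp b c)
  | FacUnion R S : factored P k R -> factored P k S -> factored P k (vunion R S)
  | FacEq R S : vrel_eq R S -> factored P k R -> factored P k S.

Lemma factored_nice (P : pred nat) k m n (R : vrel m n) :
  tame P -> (forall j, P j -> (k <= j)%N) -> factored P k R -> nice k R.
Proof.
move=> tP Pk; elim=> [E dE|b c nb nc|{}R S _ nR _ nS|{}R S RS _ nR].
- by split; [exact: tP dE|exact: tail_monotone_Rel dE].
- exact: nice_comp.
- exact: nice_union.
- exact: nice_eq nR.
Qed.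

(** Composition distributes over unions. Two expressions above [k] compose above [k]; next to a pair
    [b c], the other relation is nice and is absorbed into the adjacent factor. *)
Lemma factored_comp (P : pred nat) k m n l (R : vrel m n) (S : vrel n l) :
  tame P -> (forall j, P j -> (k <= j)%N) ->
  factored P k R -> factored P k S -> factored P k (vcomp R S).
Proof.
move=> tP Pk fR fS; elim: fR => [E dE|b c nb nc|R1 R2 _ f1 _ f2|R1 R2 R12 _ f1].
- elim: fS => [F dF|b c nb nc|S1 S2 _ f1 _ f2|S1 S2 S12 _ f1].
  + apply: (FacAbove k (E := EComp E F)) => /=; rewrite dE dF.
    by have /andP[-> _] := all_dims_in dE; have /andP[_ ->] := all_dims_in dF.
  + have nE : nice k (Rel E) by apply: factored_nice (FacAbove k dE).
    apply: FacEq (FacThrough P (nice_comp nE nb) nc) => x y; split.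
      by move=> [u [[v [xv vu]] uy]]; exists v; split=> //; exists u.
    by move=> [v [xv [u [vu uy]]]]; exists u; split=> //; exists v.
  + apply: FacEq (FacUnion f1 f2) => x y; split.
      by move=> [] [u [xu uy]]; exists u; split=> //; [left|right].
    by move=> [u [xu [uy|uy]]]; [left|right]; exists u.
  + apply: FacEq f1 => x y.
    by split=> -[u [xu /S12 uy]]; exists u.
- have nS := factored_nice tP Pk fS.
  apply: FacEq (FacThrough P nb (nice_comp nc nS)) => x y; split.
    by move=> [u [xu [v [uv vy]]]]; exists v; split=> //; exists u.
  by move=> [v [[u [xu uv]] vy]]; exists u; split=> //; exists v.
- apply: FacEq (FacUnion f1 f2) => x y; split.
    by move=> [] [u [xu uy]]; exists u; split=> //; [left|right].
  by move=> [u [[xu|xu] uy]]; [left|right]; exists u.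
- apply: FacEq f1 => x y.
  by split=> -[u [/R12 xu uy]]; exists u.
Qed.

(* Quantifying over all [r] that may be iterated together with any expression
   above [k] lets the components [E] and [b c] of a factored relation be
   absorbed in any order. *)
Lemma factored_star_absorb (P : pred nat) k m (R : vrel m m) :
  tame P -> (forall j, P j -> (k <= j)%N) -> factored P k R ->
  forall r : vrel m m,
    (forall E : expr m m, all_dims P E -> factored P k (star (vunion (Rel E) r))) ->
    forall E : expr m m, all_dims P E ->
      factored P k (star (vunion (Rel E) (vunion r R))).
Proof.
move=> tP Pk; elim=> [F dF|b c nb nc|R1 R2 _ f1 _ f2|R1 R2 R12 _ f1] r fr E dE.
- have dEF : all_dims P (EUnion E F).
    by rewrite /= dE dF; have /andP[-> _] := all_dims_in dE.
  apply: FacEq (fr _ dEF); apply: vrel_eq_star => x y /=.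
  by rewrite /vunion; tauto.
(* The loop [c s b], with [s] the star already factored, is a nice relation on N^k, so its star is
   allowed. *)
- have fs := fr _ dE; have ns := factored_nice tP Pk fs.
  have nsb := nice_comp ns nb.
  have f := FacThrough P (nice_comp nsb (nice_star (nice_comp nc nsb)))
    (nice_comp nc ns).
  apply: FacEq (FacUnion fs f) => x y; rewrite -(star_union_comp _ b c x y).
  by apply: vrel_eq_star => {x y} x y; rewrite /vunion; tauto.
(* First [R1] is absorbed into [r], then [R2] into the result. *)
- apply: FacEq (f2 _ (f1 _ fr) _ dE); apply: vrel_eq_star => x y.
  by rewrite /vunion; tauto.
- apply: FacEq (f1 _ fr _ dE); apply: vrel_eq_star => x y.
  by rewrite /vunion; have := R12 x y; tauto.
Qed.

Lemma factored_star (P : pred nat) k m (R : vrel m m) :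
  tame P -> (forall j, P j -> (k <= j)%N) -> P m ->
  factored P k R -> factored P k (star R).
Proof.
move=> tP Pk Pm fR.
(* Absorption starts with the identity as both [E] and [r], which adds nothing under a star. *)
have dI : all_dims P (EId m) by rewrite /= Pm.
have fI (E : expr m m) :
    all_dims P E -> factored P k (star (vunion (Rel E) (Rel (EId m)))).
  move=> dE; apply: (FacAbove k (E := EStar (EUnion E (EId m)))).
  by rewrite /= dE Pm.
apply: FacEq (factored_star_absorb tP Pk fR fI dI) => x y; split.
  elim=> [u v [/= ->|[/= ->|uv]]|u|u v w _ uv _ vw];
    by [exact: rt_refl|exact: rt_step|exact: rt_trans uv vw].
by apply: star_mono => u v uv; right; right.
Qed.

Lemma factored_Rel (P : pred nat) k m n (E : expr m n) :
  tame P -> (forall j, P j -> (k <= j)%N) ->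
  all_dims (predU1 k P) E -> factored P k (Rel E).
Proof.
move=> tP Pk.
(* A relation with one end in N^k factors through N^k by the identity. *)
have through_l l (R : vrel k l) : nice k R -> factored P k R.
  move=> nR; apply: FacEq (FacThrough P (nice_id k) nR) => x y.
  by split=> [[z [<-]]|xy] //; exists x.
have through_r l (R : vrel l k) : nice k R -> factored P k R.
  move=> nR; apply: FacEq (FacThrough P nR (nice_id k)) => x y.
  by split=> [[z [xz <-]]|xy] //; exists y.
elim: E => {m n} [m n Y sY|m n l E IHE F IHF|m n E IHE F IHF|m E IHE] /= /and3P[].
- move=> /predU1P[mk|Pm] /predU1P[nk|Pn] _.
  + by subst m n; apply/through_l/nice_section.
  + by subst m; apply/through_l/nice_section => //; exact: Pk.
  + by subst n; apply/through_r/nice_section => //; exact: Pk.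
  + by apply: (FacAbove k (E := ESection sY)); rewrite /= Pm Pn.
- by move=> _ _ /andP[/IHE fE /IHF fF]; exact: factored_comp.
- by move=> _ _ /andP[/IHE fE /IHF fF]; exact: FacUnion.
- move=> Pm _ /IHE fE; case/predU1P: Pm => [mk|Pm]; last exact: factored_star.
  (* In dimension [k] itself the body is nice, hence monotone, and its star may be kept. *)
  by subst m; apply/through_l/nice_star; exact: factored_nice fE.
Qed.

(** Downward induction on [k], with [j] as fuel; at [j = 0] the interval is empty, so no expression
    has its dimensions there. *)
Lemma tame_interval D j k : (D < k + j)%N -> tame (fun i => k <= i <= D)%N.
Proof.
elim: j k => [|j IH] k kj m n E dE.
  by have /andP[kmD _] := all_dims_in dE; lia.
have tP : tame (fun i => k.+1 <= i <= D)%N by apply: IH; lia.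
have Pk i : (k.+1 <= i <= D)%N -> (k <= i)%N by lia.
have dE' : all_dims (predU1 k (fun i => k.+1 <= i <= D)%N) E.
  apply: all_dims_sub dE => i /= kiD; lia.
by have [] := factored_nice tP Pk (factored_Rel tP Pk dE').
Qed.

Theorem corollary10 (m n : nat) (E : expr m n) :
  exists E' : expr m n,
    (forall (x : 'rV[nat]_m) (y : 'rV[nat]_n), Rel E x y <-> Rel E' x y) /\
    (forall (d : nat) (F : expr d d), subexpr (EStar F) E' -> monotone (Rel F)).
Proof.
have [D dE] := all_dims_bounded E.
have tD : tame (fun i => 0 <= i <= D)%N by apply: (@tame_interval D D.+1 0).
have [E' EE' sE'] := tD m n E (all_dims_sub (fun _ => id) dE).
exists E'; split=> // d F FE'.
by have [] := monotone_stars_sub FE' sE'.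
Qed.
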